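(* There is an absolute constant $c>0$ such that for every $n\in\mathbb N$ with $n\ge 2$ there exists an $n$-point metric space $\mathcal M$ with $C_{\mathrm{rand}}^{\mathrm{MSS}}(\mathcal M,n-1)\ge c\log^2 n$. That is, $C_{\mathrm{rand}}^{\mathrm{MSS}}(\mathcal M,n-1)=\Omega(\log^2 n)$.
   Context: Small set chasing (metrical service systems), MSS: given a metric space $\mathcal M=(M,d)$, a starting point $x_0\in M$ and $w\in\mathbb N$, an adversary presents online a sequence of requests, each a nonempty subset of $M$ of cardinality at most $w$; upon receiving a request the algorithm must move its (single) server to some point of that subset, paying the distance travelled. The cost of an algorithm on a request sequence is its total movement; $c_{\mathrm{opt}}(\rho)$ is the minimum cost over all (offline) ways of serving $\rho$. A randomized online algorithm is a probability distribution over deterministic online algorithms. The randomized competitive ratio $C_{\mathrm{rand}}^{\mathrm{MSS}}(\mathcal M,w)$ is the infimum of all $C$ for which there exist a randomized online algorithm $\tilde A$ and a constant $\kappa$ such that for every request sequence $\rho$, $\mathbb E_{A\sim\tilde A}[c_A(\rho)]\le C\cdot c_{\mathrm{opt}}(\rho)+\kappa$. *)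

(* Defs.v *)
From HB Require Import structures.
From mathcomp Require Import all_boot all_order all_algebra finmap.
From mathcomp Require Import all_classical all_reals all_analysis.

Set Implicit Arguments.
Unset Strict Implicit.
Unset Printing Implicit Defensive.

Import Order.TTheory GRing.Theory Num.Theory.

Local Open Scope classical_set_scope.
Local Open Scope ring_scope.

Section MetricalServiceSystems.
Context {R : realType} {M : metricType R}.
Implicit Types (x : M) (w : nat).

Definition request w :=
  {r : {fset M} | (r != fset0)%fset && (#|` r|%fset <= w)%N}.

Definition movement (x : M) (s : seq M) : R :=
  \sum_(l <- pairmap (@mdist R M) x s) l.

Definition serves w (rho : seq (request w)) (s : seq M) : bool :=
  all2 (fun x (r : request w) => x \in val r) s rho.

(* The infimum is over finitely many schedules, at least one: a minimum. *)
Definition opt_cost x0 w (rho : seq (request w)) : R :=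
  inf [set movement x0 s | s in [set s | serves rho s]].

(* A deterministic online algorithm gives the position of the server as a
   function of the requests received so far. *)
Record online_algorithm x0 w := OnlineAlgorithm {
  position :> seq (request w) -> M ;
  position_nil : position [::] = x0 ;
  position_rcons : forall rho r, position (rcons rho r) \in val r }.

Definition trajectory x0 w (A : online_algorithm x0 w) (rho : seq (request w))
  : seq M := [seq A (take i.+1 rho) | i <- iota 0 (size rho)].

Definition alg_cost x0 w (rho : seq (request w)) (A : online_algorithm x0 w)
  : R := movement x0 (trajectory A rho).

Lemma request_inhabited w (r : request w) : exists x, x \in val r.
Proof. by case: r => r /= /andP[/fset0Pn]. Qed.

(* Some online algorithm; measurable types have to be inhabited. *)
Definition default_algorithm x0 w : online_algorithm x0 w.
Proof.
exists (fun rho => last x0 [seq xchoose (request_inhabited r) | r <- rho]).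
  by [].
by move=> rho r; rewrite map_rcons last_rcons; exact: xchooseP.
Defined.

HB.instance Definition _ x0 w := gen_eqMixin (online_algorithm x0 w).
HB.instance Definition _ x0 w := gen_choiceMixin (online_algorithm x0 w).
HB.instance Definition _ x0 w :=
  isPointed.Build (online_algorithm x0 w) (default_algorithm x0 w).

(* As A rho ranges over a finite set when rho is fixed, these events generate
   the product sigma-algebra, i.e. the one that makes all decisions
   measurable. *)
Definition decision_events x0 w : set (set (online_algorithm x0 w)) :=
  [set E | exists rho x, E = [set A : online_algorithm x0 w | A rho = x]].

Definition algorithm_space x0 w := g_sigma_algebraType (@decision_events x0 w).

Definition randomized_algorithm x0 w := probability (algorithm_space x0 w) R.

Definition competitive x0 w (P : randomized_algorithm x0 w) (C : R) :=
  exists kappa : R, forall rho : seq (request w),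
    ('E_P[@alg_cost x0 w rho] <= (C * opt_cost x0 rho + kappa)%:E)%E.

(* Equal to +oo when no randomized algorithm is competitive. *)
Definition C_rand_MSS x0 w : \bar R :=
  ereal_inf [set C%:E | C in
    [set C : R | exists P : randomized_algorithm x0 w, competitive P C]].

End MetricalServiceSystems.

(* Main.v *)
Require Import Defs.
From HB Require Import structures.
From mathcomp Require Import all_boot all_order all_algebra finmap.
From mathcomp Require Import all_classical all_reals all_analysis.
From mathcomp Require Import lra.

Set Implicit Arguments.
Unset Strict Implicit.
Unset Printing Implicit Defensive.

Import Order.TTheory GRing.Theory Num.Theory.

Local Open Scope classical_set_scope.
Local Open Scope ring_scope.

(* A pass of level [k] is a random request sequence that drives the server from
   one end of a diamond-like space to the other, while a clairvoyant server only
   pays the length of a geodesic. Suppose that passes of level [k] cost an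
   online server [C] per unit of length. In the middle third of the diamond of
   level [k + 1] there are two branches, far from each other, each with a copy
   of the diamond of level [k]. Fair coins decide which of the two branches
   advances in its pass, by pieces that cost about as much as changing branches,
   so that nothing is gained by changing. After about [C] coins one branch has a
   lead of order [sqrt C] pieces; it is then closed, and the other branch, which
   still has more to come, completes its pass. The clairvoyant server pays
   nothing extra, but the online server pays [C + c sqrt C] per unit of length.
   Hence the ratio is of order [k ^ 2] at level [k], with [5 * 6 ^ k] points. *)

(** * Fair races *)

(* The tangent at [s * `|q| = 3 / 2]. *)
Lemma quartic_le_norm (R : realFieldType) (s q : R) : 0 <= s ->
  s * q ^+ 2 - 4 / 27 * s ^+ 3 * q ^+ 4 <= `|q|.
Proof.
move=> s0; rewrite -(real_normK (num_real q)) -[q ^+ 4]/(q ^+ (2 * 2)) exprM.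
rewrite -(real_normK (num_real q)); set p := `|q|.
have p0 : 0 <= p by exact: normr_ge0.
have : 0 <= p * ((s * p + 3) * (s * p - 3 / 2) ^+ 2).
  by rewrite mulr_ge0 // mulr_ge0 ?sqr_ge0 // addr_ge0 // mulr_ge0.
by lra.
Qed.

Section Lead.
Context {R : realFieldType}.
Variable D : R.
Implicit Types (n : nat) (q s : R).

(* The mean of the positive part of [q] plus [n] independent fair signs times
   [D]. *)
Fixpoint lead n q : R :=
  if n is m.+1 then (lead m (q + D) + lead m (q - D)) / 2 else Num.max 0 q.

Lemma lead_ge0 n q : 0 <= lead n q.
Proof.
elim: n q => [|n IH] q /=; first by rewrite le_max lexx.
by rewrite divr_ge0 // addr_ge0.
Qed.

Lemma lead_skew n q : lead n q - lead n (- q) = q.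
Proof.
elim: n q => [|n IH] q /=.
  by case: (leP 0 q); case: (leP 0 (- q)) => *; lra.
by have := IH (q + D); have := IH (q - D); rewrite !opprD opprK; lra.
Qed.

Lemma lead_lip n q s : 0 <= s -> lead n q <= lead n (q + s) <= lead n q + s.
Proof.
move=> s0; elim: n q => [|n IH] q /=.
  by case: (leP 0 q); case: (leP 0 (q + s)) => *; lra.
by have := IH (q + D); have := IH (q - D); rewrite !(addrAC q s); lra.
Qed.

Lemma lead_coin n q : 0 <= D ->
  lead n (q - D) <= lead n (q + D) <= lead n (q - D) + 2 * D.
Proof.
move=> /lead_lip lip; have := lip n (q - D); have := lip n q.
by rewrite subrK; lra.
Qed.

(* [2 * lead n q - q] is the mean of the absolute value of the walk, which is
   compared with its moments of order 2 and 4. *)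
Lemma lead_moments n s q : 0 <= s ->
  s * (q ^+ 2 + n%:R * D ^+ 2) - 4 / 27 * s ^+ 3 *
    (q ^+ 4 + 6 * n%:R * (q * D) ^+ 2 + (3 * n%:R ^+ 2 - 2 * n%:R) * D ^+ 4)
  <= 2 * lead n q - q.
Proof.
move=> s0; elim: n q => [|n IH] q /=.
  rewrite !(mul0r, mulr0, addr0, subrr, expr0n) /=.
  apply: le_trans (quartic_le_norm q s0) _.
  by case: (ger0P q) => q0; rewrite ?(max_idPr q0) ?(max_idPl (ltW q0)); lra.
by have := IH (q + D); have := IH (q - D); rewrite -(natr1 n); lra.
Qed.

End Lead.

(* The moments are compared at [s = 3 / (2 t D)], with [t ^ 2 = 3 n]. *)
Lemma lead_sqrt (R : rcfType) (D : R) n :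
  D * Num.sqrt (3 * n%:R) / 6 <= lead D n 0.
Proof.
set t := Num.sqrt _; have [tD|] := leP (t * D) 0.
  by have := lead_ge0 D n 0; lra.
move=> tD; have tn : t ^+ 2 = 3 * n%:R by rewrite sqr_sqrtr // mulr_ge0.
set v := (t * D)^-1; have tDv : t * D * v = 1 by rewrite mulfV ?gt_eqF.
have v0 : 0 <= v by rewrite invr_ge0 ltW.
have s0 : 0 <= 3 / 2 * v by lra.
have := lead_moments D n 0 s0; rewrite mul0r !expr0n /= !(mulr0, add0r, subr0).
have -> : (n%:R : R) = t ^+ 2 / 3 by rewrite tn; lra.
have -> : 3 / 2 * v * (t ^+ 2 / 3 * D ^+ 2) = t * D * v * (t * D) / 2 by lra.
have -> : 4 / 27 * (3 / 2 * v) ^+ 3 *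
    ((3 * (t ^+ 2 / 3) ^+ 2 - 2 * (t ^+ 2 / 3)) * D ^+ 4)
  = (t * D * v) ^+ 3 * (t * D) / 6 - (t * D * v) ^+ 2 * v * D ^+ 2 / 3 by lra.
have : 0 <= v * D ^+ 2 by rewrite mulr_ge0 // sqr_ge0.
by rewrite tDv !expr1n !mul1r; lra.
Qed.

(** * Random request sequences with a potential *)

Section Forces.
Context {R : realFieldType} {X : Type}.

(* [points] is the last request, [potential x] a lower bound on the expected
   cost still to come for an online server at [x], and [level] a value close to
   [potential] that does not depend on [x], whose decrease measures the progress
   of the adversary. *)
Record state := State {
  points : X -> bool ; potential : X -> R ; level : R }.

Implicit Types (d : X -> X -> R) (clock : X -> R) (dom : X -> bool) (step : R).
Implicit Types (n m : state) (F G : set state) (z : R).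

(* The factor [3 / 2] is the one that a race reproduces when it multiplies
   [step] by 3, as [3 / 2 * step + 3 * step = 3 / 2 * (3 * step)]. *)
Record state_ok d dom step n : Prop := StateOk {
  state_inhabited : exists x, points n x ;
  state_dom : forall x, points n x -> dom x ;
  state_lip : forall x y, points n x -> points n y ->
    potential n x <= d x y + potential n y ;
  state_band : forall x, points n x ->
    level n - 3 / 2 * step <= potential n x <= level n + 3 / 2 * step }.

(* [clock] bounds the offline cost: by [move_reach], every point [x] of the
   current request is reached by a clairvoyant server that has paid [clock x],
   up to a constant. *)
Record move_ok d clock step n m : Prop := MoveOk {
  move_potential : forall x y, points n x -> points m y ->
    potential n x <= d x y + potential m y ;
  move_reach : forall y, points m y ->
    exists2 x, points n x & d x y <= clock y - clock x ;
  move_level : level m <= level n <= level m + step }.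

Record flip_ok step n (a : bool -> state) : Prop := FlipOk {
  flip_points : forall b, points (a b) =1 points n ;
  flip_potential : forall x, points n x ->
    potential n x <= (potential (a true) x + potential (a false) x) / 2 ;
  flip_level : forall b, level (a b) <= level n <= level (a b) + step }.

(* From state [n], an adversary that flips fair coins reaches a state of [F]. *)
Inductive forces d clock dom step F : state -> Prop :=
| forces_stop n : state_ok d dom step n -> F n -> forces d clock dom step F n
| forces_move n m : state_ok d dom step n -> move_ok d clock step n m ->
    forces d clock dom step F m -> forces d clock dom step F n
| forces_flip n a : state_ok d dom step n -> flip_ok step n a ->
    (forall b, forces d clock dom step F (a b)) -> forces d clock dom step F n.

Lemma forces_ok d clock dom step F n :
  forces d clock dom step F n -> state_ok d dom step n.
Proof. by case. Qed.

Lemma forces_bind d clock dom step F G n :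
  forces d clock dom step F n ->
  (forall m, state_ok d dom step m -> F m -> forces d clock dom step G m) ->
  forces d clock dom step G n.
Proof.
move=> nF FG; elim: nF => {n} [n|n m nok nm _|n a nok na _]; first exact: FG.
  exact: forces_move.
exact: forces_flip.
Qed.

Lemma forces_weaken d clock dom dom' step step' F n :
  (forall x, dom x -> dom' x) -> step <= step' ->
  forces d clock dom step F n -> forces d clock dom' step' F n.
Proof.
move=> domS stepS.
have okW m : state_ok d dom step m -> state_ok d dom' step' m.
  case=> mI mD mL mB; split=> // x mx; first exact/domS/mD.
  by have := mB x mx; lra.
elim=> {n} [n /okW|n m /okW nok [? ? ?] _ IH|n a /okW nok [? ? al] _ IH].
- exact: forces_stop.
- by apply: forces_move nok _ IH; split=> //; lra.
- by apply: forces_flip nok _ IH; split=> // b; have := al b; lra.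
Qed.

Definition flat z n :=
  level n = z /\ forall x, points n x -> potential n x = z.

Definition flat_state (S : X -> bool) z := State S (fun=> z) z.

Lemma flat_state_ok d dom step (S : X -> bool) z :
  (forall x y, 0 <= d x y) -> 0 <= step ->
  (exists x, S x) -> (forall x, S x -> dom x) ->
  state_ok d dom step (flat_state S z).
Proof.
by move=> d0 s0 Sx Sd; split=> //= [x y _ _|x _]; [rewrite lerDr|lra].
Qed.

Lemma flat_move d clock step z n m :
  (forall x y, 0 <= d x y) -> 0 <= step -> flat z n -> flat z m ->
  (forall y, points m y -> exists2 x, points n x &
    d x y <= clock y - clock x) ->
  move_ok d clock step n m.
Proof.
move=> d0 s0 [nl np] [ml mp] reach; split=> //.
  by move=> x y nx my; rewrite np // mp // lerDr.
by rewrite nl ml; lra.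
Qed.

(* A state is followed through [f] until its level falls to [target]. *)
Lemma forces_until d clock dom dom' step step' F G target slack f n :
  let within m :=
    state_ok d dom step m /\ target - step <= level m <= target + slack in
  0 <= slack ->
  (forall m, F m -> level m <= target) ->
  (forall m, within m -> state_ok d dom' step' (f m)) ->
  (forall m m', within m -> within m' -> move_ok d clock step m m' ->
    move_ok d clock step' (f m) (f m')) ->
  (forall m a, within m -> flip_ok step m a -> flip_ok step' (f m) (f \o a)) ->
  (forall m, forces d clock dom step F m ->
    target - step <= level m <= target ->
    forces d clock dom' step' G (f m)) ->
  forces d clock dom step F n -> target - step <= level n <= target + slack ->
  forces d clock dom' step' G (f n).
Proof.
move=> within slack0 F_target f_ok f_move f_flip f_forces.
elim=> {n} [n nok Fn|n m nok nm mF IH|n a nok na aF IH] nl.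
- by apply: f_forces; [exact: forces_stop|have := F_target n Fn; lra].
- have [low|high] := leP (level n) target.
    by apply: f_forces; [exact: forces_move nm mF|lra].
  have ml : target - step <= level m <= target + slack.
    by have := move_level nm; lra.
  apply: forces_move (IH ml); first exact: f_ok.
  by apply: f_move => //; split=> //; exact: forces_ok mF.
- have [low|high] := leP (level n) target.
    by apply: f_forces; [exact: forces_flip na aF|lra].
  have al b : target - step <= level (a b) <= target + slack.
    by have := flip_level na b; lra.
  apply: (@forces_flip _ _ _ _ _ _ (f \o a)) => [||b]; first exact: f_ok.
    exact: f_flip.
  exact: IH.
Qed.

End Forces.
Arguments state : clear implicits.

Section Pull.
Context {R : realFieldType} {X Y : Type}.
Variables (dom : Y -> bool) (f : Y -> X) (a : R).

Definition pull (n : state R X) : state R Y :=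
  State (fun y => dom y && points n (f y)) (fun y => potential n (f y) + a)
    (level n + a).

Lemma flat_pull z n : flat z n -> flat (z + a) (pull n).
Proof. by move=> [<- np]; split=> //= y /andP[_ /np ->]. Qed.

Variables (d : X -> X -> R) (d' : Y -> Y -> R).
Variables (clock : X -> R) (clock' : Y -> R) (delay step : R).
Hypothesis dom_inhabited : exists y, dom y.
Hypothesis le_dist : forall y y', dom y -> dom y' -> d (f y) (f y') <= d' y y'.
Hypothesis dist_lift : forall x y, dom y ->
  exists y', [/\ dom y', f y' = x & d' y' y <= d x (f y)].
Hypothesis clock_pull : forall y, dom y -> clock' y = clock (f y) + delay.

Lemma pull_ok n : state_ok d predT step n -> state_ok d' dom step (pull n).
Proof.
case=> [[x nx] _ n_lip n_band]; split=> /=.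
- have [y dy] := dom_inhabited; have [y' [dy' fy' _]] := dist_lift x dy.
  by exists y'; rewrite dy' fy'.
- by move=> y /andP[].
- move=> y y' /andP[dy ny] /andP[dy' ny'].
  by have := n_lip _ _ ny ny'; have := le_dist dy dy'; lra.
- by move=> y /andP[_ /n_band]; lra.
Qed.

Lemma pull_move n m :
  move_ok d clock step n m -> move_ok d' clock' step (pull n) (pull m).
Proof.
case=> nm_pot nm_reach nm_level; split=> /=; last by lra.
- move=> y y' /andP[dy ny] /andP[dy' my'].
  by have := nm_pot _ _ ny my'; have := le_dist dy dy'; lra.
- move=> y /andP[dy /nm_reach[x nx dxy]].
  have [y' [dy' fy' d'y]] := dist_lift x dy.
  exists y'; first by rewrite dy' fy'.
  by rewrite (le_trans d'y) // !clock_pull // fy'; lra.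
Qed.

Lemma forces_pull F n : forces d clock predT step F n ->
  forces d' clock' dom step (pull @` F) (pull n).
Proof.
elim=> {n} [n nok Fn|n m /pull_ok nok nm _ IH|
  n b /pull_ok nok [b_points b_pot b_level] _ IH].
- by apply: forces_stop; [exact: pull_ok|exists n].
- exact: forces_move (pull_move nm) IH.
- apply: (forces_flip (a := pull \o b)) => //; split=> /=.
  + by move=> c y; rewrite b_points.
  + by move=> y /andP[_ /b_pot]; lra.
  + by move=> c; have := b_level c; lra.
Qed.

End Pull.

Section Race.
Context {R : realFieldType} {X : Type}.
Variables (d : X -> X -> R) (clock : X -> R) (side : X -> bool).
Variables (dom : bool -> X -> bool) (step end_level : R).
Variables (F : bool -> set (state R X)) (G : set (state R X)).
Hypothesis step0 : 0 <= step.
Hypothesis dist_refl : forall x, d x x = 0.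
Hypothesis dom_side : forall b x, dom b x -> side x = b.
(* Changing branches gains nothing if it costs at least twice the half-width
   [3 / 2 * step] of the band, plus a piece [3 * step], plus an overshoot
   [step]. *)
Hypothesis dom_gap : forall b x y,
  dom b x -> dom (~~ b) y -> 7 * step <= d x y.
Hypothesis final_level : forall b n, F b n -> level n <= end_level.
Hypothesis finish : forall b n, forces d clock (dom b) step (F b) n ->
  forces d clock predT (3 * step) G n.
Implicit Types (n : nat) (t : bool -> R) (b c : bool).
Implicit Types (m : state R X) (a : bool -> state R X).

Local Notation D := (3 * step).
Local Notation ok b := (state_ok d (dom b) step).
Local Notation branch_forces b := (forces d clock (dom b) step (F b)).
Local Notation race_forces := (forces d clock predT D G).

(* The race with [n] coins to go, between two branches in the states [a], of
   levels about [t]. A server in branch [b] that stays there pays about [t b],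
   plus the advance of the branch if it is closed at the end, since the other
   branch still has that much more to come. *)
Definition race n t a : state R X :=
  State (fun x => points (a (side x)) x)
    (fun x => potential (a (side x)) x + lead D n (t (~~ side x) - t (side x)))
    (t true + lead D n (t false - t true)).

Definition on_track t b m := ok b m /\ t b - step <= level m <= t b + D.

Lemma lead_swap n t b : t b + lead D n (t (~~ b) - t b) =
  t (~~ b) + lead D n (t b - t (~~ b)).
Proof. by have := lead_skew D n (t (~~ b) - t b); rewrite opprB; lra. Qed.

Lemma race_level n t a b :
  level (race n t a) = t b + lead D n (t (~~ b) - t b).
Proof. by case: b => //; rewrite lead_swap. Qed.

Lemma race_lip n t a a' x y :
  (forall b, on_track t b (a b)) -> (forall b, on_track t b (a' b)) ->
  (forall b x y, points (a b) x -> points (a' b) y ->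
    potential (a b) x <= d x y + potential (a' b) y) ->
  points (race n t a) x -> points (race n t a') y ->
  potential (race n t a) x <= d x y + potential (race n t a') y.
Proof.
move=> a_track a'_track aa' /= ax a'y; have [xy|yx] := eqVneq (side x) (side y).
  by rewrite xy in ax *; have := aa' _ _ _ ax a'y; lra.
have {yx} yx : side y = ~~ side x by case: (side x) (side y) yx => [] [].
rewrite {}yx in a'y *; have [aok a_level] := a_track (side x).
have [a'ok a'_level] := a'_track (~~ side x); have := lead_swap n t (side x).
have := dom_gap (state_dom aok ax) (state_dom a'ok a'y).
by have := state_band aok ax; have := state_band a'ok a'y; rewrite negbK; lra.
Qed.

Lemma race_ok n t a : (forall b, on_track t b (a b)) ->
  state_ok d predT D (race n t a).
Proof.
move=> a_track; split=> //.
- have [aok _] := a_track true; have [x ax] := state_inhabited aok; exists x.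
  by rewrite /= (dom_side (state_dom aok ax)).
- move=> x y ax ay; apply: race_lip => // b; exact: state_lip (a_track b).1.
- move=> x ax; rewrite (race_level n t a (side x)) /=.
  by have [aok] := a_track (side x); have := state_band aok ax; lra.
Qed.

Lemma on_track_update t a b m : (forall c, on_track t c (a c)) ->
  on_track t b m -> forall c, on_track t c ([eta a with b |-> m] c).
Proof. by move=> a_track m_track c /=; case: eqP => [->|]. Qed.

Lemma race_move n t a b m m' : (forall c, on_track t c (a c)) ->
  on_track t b m -> on_track t b m' -> move_ok d clock step m m' ->
  move_ok d clock D
    (race n t [eta a with b |-> m]) (race n t [eta a with b |-> m']).
Proof.
move=> a_track m_track m'_track [mm'_pot mm'_reach _]; split.
- move=> x y; apply: race_lip; try exact: on_track_update.
  move=> c {}x {}y /=; case: eqP => _; first exact: mm'_pot.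
  by have [aok _] := a_track c; exact: state_lip aok _ _.
- move=> y /=; case: eqP => [yb m'y|/eqP yb ay]; last first.
    by exists y; rewrite ?dist_refl ?subrr //= (negbTE yb).
  have [x mx dxy] := mm'_reach y m'y; exists x => //.
  by rewrite (dom_side (state_dom m_track.1 mx)) eqxx.
- by rewrite lexx lerDl mulr_ge0.
Qed.

Lemma race_flip n t a b m (f : bool -> state R X) : flip_ok step m f ->
  flip_ok D (race n t [eta a with b |-> m])
    (fun c => race n t [eta a with b |-> f c]).
Proof.
case=> f_points f_pot _; split.
- by move=> c x /=; case: eqP => //= _; rewrite f_points.
- by move=> x /=; case: eqP => [_ /f_pot|_ _]; lra.
- by move=> c; rewrite lexx lerDl mulr_ge0.
Qed.

Lemma race_coin n t a : flip_ok D (race n.+1 t a)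
  (fun b => race n [eta t with b |-> t b - D] a).
Proof.
have advl u v : u - D - v = u - v - D by rewrite addrAC.
have advr u v : u - (v - D) = u - v + D by rewrite opprB addrA addrAC.
have D0 : 0 <= D by rewrite mulr_ge0.
split=> //.
  by move=> x _ /=; case: (side x) => /=; rewrite !(advl, advr); lra.
have lead_le := lead_coin n (t false - t true) D0.
by case=> /=; rewrite !(advl, advr); lra.
Qed.

(* The branch that has more to come survives. *)
Lemma race_close t a b : (forall c, on_track t c (a c)) ->
  t b - step <= level (a b) <= t b -> t (~~ b) <= t b ->
  move_ok d clock D (race 0 t a) (a b).
Proof.
move=> a_track ab_level tb.
have lead0 : lead D 0 (t (~~ b) - t b) = 0 by rewrite /= max_l // subr_le0.
have side_b y : points (a b) y -> side y = b.
  by move=> /(state_dom (a_track b).1)/dom_side.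
split.
- move=> x y ax ay; have ay' : points (race 0 t a) y by rewrite /= side_b.
  have -> : potential (a b) y = potential (race 0 t a) y.
    by rewrite -[LHS]addr0 -lead0 /= (side_b y ay).
  exact: race_lip (fun c => state_lip (a_track c).1) ax ay'.
- by move=> y ay; exists y; rewrite ?dist_refl ?subrr //= (side_b y ay).
- by rewrite (race_level _ _ _ b) lead0; lra.
Qed.

Lemma forces_advance n t a b : (forall c, on_track t c (a c)) ->
  branch_forces b (a b) -> end_level <= t b ->
  (forall m, branch_forces b m -> t b - step <= level m <= t b ->
    race_forces (race n t [eta a with b |-> m])) ->
  race_forces (race n t a).
Proof.
move=> a_track ab_forces le_t advanced.
have <- : [eta a with b |-> a b] = a :> (bool -> state R X).
  by apply/funext => c /=; case: eqP => [->|].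
apply: (forces_until (f := fun m => race n t [eta a with b |-> m])
  _ _ _ _ _ advanced ab_forces (a_track b).2).
- by rewrite mulr_ge0.
- by move=> m /final_level; lra.
- by move=> m m_track; apply: race_ok; exact: on_track_update.
- by move=> m m' m_track m'_track; exact: race_move.
- by move=> m f _; exact: race_flip.
Qed.

Lemma forces_on_track t b m : branch_forces b m ->
  t b - step <= level m <= t b -> on_track t b m.
Proof. by move=> /forces_ok mok ?; split=> //; lra. Qed.

Lemma forces_race n t a : (forall b, branch_forces b (a b)) ->
  (forall b, t b - step <= level (a b) <= t b) ->
  (forall b, end_level <= t b - n%:R * D) -> race_forces (race n t a).
Proof.
have D0 : 0 <= D by rewrite mulr_ge0.
elim: n t a => [|n IH] t a a_forces a_level le_t.
  have a_track b := forces_on_track (a_forces b) (a_level b).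
  suff [b tb] : exists b, t (~~ b) <= t b.
    apply: forces_move (finish (a_forces b)); first exact: race_ok.
    exact: race_close.
  by case: (leP (t false) (t true)) => [?|/ltW ?]; [exists true|exists false].
have a_track b := forces_on_track (a_forces b) (a_level b).
apply: forces_flip (@race_coin n t a) _ => [|b]; first exact: race_ok.
set t' : bool -> R := [eta t with b |-> t b - D].
have t'b : t' b = t b - D by rewrite /t' /= eqxx.
have t'c c : c != b -> t' c = t c by rewrite /t' /= => /negbTE ->.
have le_t' c : end_level <= t' c - n%:R * D.
  have := le_t c; rewrite -(natr1 n).
  by have [->|/t'c ->] := eqVneq c b; lra.
have nD0 : 0 <= n%:R * D by rewrite mulr_ge0.
apply: (forces_advance _ (a_forces b)) => [c||m m_forces m_level].
- have [aok _] := a_track c; split=> //; have := a_level c.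
  by have [->|/t'c ->] := eqVneq c b; lra.
- by have := le_t' b; lra.
- apply: IH => // c /=; case: eqVneq => [-> //|cb]; first exact: a_forces.
  by rewrite t'c //; exact: a_level.
Qed.

End Race.

(** * Diamonds and their passes *)

Lemma maxr_leD (R : realDomainType) (x y z x' y' z' : R) :
  x <= y + z -> x' <= y' + z' ->
  Num.max x x' <= Num.max y y' + Num.max z z'.
Proof.
move=> xyz xyz'; rewrite ge_max (le_trans xyz) ?(le_trans xyz') //;
  by rewrite lerD // le_max lexx ?orbT.
Qed.

Section Diamonds.
Context {R : realFieldType}.

(* In the point [(c, b, x)] of level [k + 1], [c] is the third of the diamond,
   [b] the side and [x] a point of a diamond of level [k]. The side only matters
   for the distance through [height], which vanishes at both ends. *)
Fixpoint diamond k : finType :=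
  if k is m.+1 then ('I_3 * bool * diamond m)%type : finType else 'I_5.

Lemma card_diamond k : #|diamond k| = (5 * 6 ^ k)%N.
Proof.
elim: k => [|k IH] /=; first by rewrite card_ord.
by rewrite !card_prod IH card_ord card_bool expnS mulnCA.
Qed.

Definition len k : R := 4 * 3 ^+ k.

Fixpoint abscissa k : diamond k -> R :=
  if k is m.+1 then fun x => x.1.1%:R * len m + abscissa x.2
  else fun x : 'I_5 => x%:R.

Definition tent k (x : diamond k) : R :=
  Num.min (abscissa x) (len k - abscissa x).

Definition height k (x : diamond k.+1) : R :=
  if x.1.2 then tent x else - tent x.

Fixpoint fold_dist k : diamond k -> diamond k -> R :=
  if k is m.+1 then
    fun x y => Num.max `|height x - height y| (fold_dist x.2 y.2)
  else fun _ _ => 0.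

Definition base_dist k (x y : diamond k) : R :=
  Num.max `|abscissa x - abscissa y| (fold_dist x y).

(* A clairvoyant server is at [x] at time [clock x]: it visits the 5 points of
   each diamond of level 0 at unit speed, and a step of unit length leads to the
   next one. *)
Fixpoint clock k : diamond k -> R :=
  if k is m.+1 then fun x => x.1.1%:R * (5 * 3 ^+ m) + clock x.2
  else fun x : 'I_5 => x%:R.

Fixpoint at_start k : diamond k -> bool :=
  if k is m.+1 then fun x => (x.1.1 == 0) && at_start x.2
  else fun x : 'I_5 => x == 0.

Fixpoint at_stop k : diamond k -> bool :=
  if k is m.+1 then fun x => (x.1.1 == 2) && at_stop x.2
  else fun x : 'I_5 => x == 4.

Fixpoint origin k : diamond k :=
  if k is m.+1 then ((0, true), origin m) else 0.

Lemma len_gt0 k : 0 < len k.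
Proof. by rewrite mulr_gt0 ?exprn_gt0. Qed.

Lemma lenS k : len k.+1 = 3 * len k.
Proof. by rewrite /len exprS mulrCA. Qed.

Lemma abscissa_ge0 k (x : diamond k) : 0 <= abscissa x.
Proof.
elim: k x => [|k IH] x /=; first exact: ler0n.
by rewrite addr_ge0 // mulr_ge0 // ltW // len_gt0.
Qed.

Lemma abscissa_le k (x : diamond k) : abscissa x <= len k.
Proof.
elim: k x => [|k IH] x /=.
  by rewrite /len expr0 mulr1 (ler_nat _ _ 4) -ltnS.
have : x.1.1%:R * len k <= 2 * len k.
  by rewrite ler_wpM2r ?(ltW (len_gt0 k)) // (ler_nat _ _ 2) -ltnS.
by have := IH x.2; rewrite lenS; lra.
Qed.

Lemma abscissaB2 k (x y : diamond k.+1) : x.1.1 = y.1.1 ->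
  abscissa x.2 - abscissa y.2 = abscissa x - abscissa y.
Proof. by move=> xy; rewrite /= xy opprD addrACA subrr add0r. Qed.

Lemma abscissa_start k (x : diamond k) : at_start x -> abscissa x = 0.
Proof.
elim: k x => [|k IH] x /= => [/eqP -> //|/andP[/eqP -> /IH ->]].
by rewrite mul0r addr0.
Qed.

Lemma abscissa_stop k (x : diamond k) : at_stop x -> abscissa x = len k.
Proof.
elim: k x => [|k IH] x /= => [/eqP ->|/andP[/eqP -> /IH ->]].
  by rewrite /len expr0 mulr1.
by rewrite lenS -[nat_of_ord 2]/2%N; lra.
Qed.

Lemma clock_start k (x : diamond k) : at_start x -> clock x = 0.
Proof.
elim: k x => [|k IH] x /= => [/eqP -> //|/andP[/eqP -> /IH ->]].
by rewrite mul0r addr0.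
Qed.

Lemma clock_stop k (x : diamond k) : at_stop x -> clock x = 5 * 3 ^+ k - 1.
Proof.
elim: k x => [|k IH] x /= => [/eqP ->|/andP[/eqP -> /IH ->]].
  by rewrite expr0 -[nat_of_ord 4]/4%N; lra.
by rewrite exprS -[nat_of_ord 2]/2%N; lra.
Qed.

Lemma tent_ge0 k (x : diamond k) : 0 <= tent x.
Proof. by rewrite le_min abscissa_ge0 subr_ge0 abscissa_le. Qed.

Lemma tent_le k (x : diamond k) : 2 * tent x <= len k.
Proof. by rewrite /tent; case: (leP (abscissa x)); lra. Qed.

Lemma tent_lip k (x y : diamond k) :
  `|tent x - tent y| <= `|abscissa x - abscissa y|.
Proof.
rewrite /tent ler_norml; set u := `|_|.
have := ler_norm (abscissa x - abscissa y).
have := ler_norm (abscissa y - abscissa x); rewrite distrC -/u.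
by case: (leP (abscissa x)); case: (leP (abscissa y)) => *; lra.
Qed.

Lemma height_lip k (x y : diamond k.+1) : x.1.2 = y.1.2 ->
  `|height x - height y| <= `|abscissa x - abscissa y|.
Proof.
rewrite /height => ->; case: y.1.2; first exact: tent_lip.
by rewrite -opprD normrN tent_lip.
Qed.

Lemma height_le k (x y : diamond k.+1) : `|height x - height y| <= len k.+1.
Proof.
have := tent_le x; have := tent_le y; have := tent_ge0 x; have := tent_ge0 y.
by rewrite /height ler_norml; case: ifP; case: ifP; lra.
Qed.

Lemma height_flat k (x : diamond k.+1) :
  at_start x || at_stop x -> height x = 0.
Proof.
suff tent0 : at_start x || at_stop x -> tent x = 0.
  by move=> /tent0; rewrite /height => ->; rewrite oppr0 if_same.
have len0 := ltW (len_gt0 k.+1).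
case/orP => [/abscissa_start|/abscissa_stop]; rewrite /tent => ->.
  by rewrite subr0 min_l.
by rewrite subrr min_r.
Qed.

Lemma fold_dist_refl k (x : diamond k) : fold_dist x x = 0.
Proof. by elim: k x => [|k IH] x //=; rewrite subrr normr0 IH maxxx. Qed.

Lemma fold_dist_sym k (x y : diamond k) : fold_dist x y = fold_dist y x.
Proof. by elim: k x y => [|k IH] x y //=; rewrite distrC IH. Qed.

Lemma fold_dist_triangle k (y x z : diamond k) :
  fold_dist x z <= fold_dist x y + fold_dist y z.
Proof.
elim: k y x z => [|k IH] y x z /=; first by rewrite addr0.
by apply: maxr_leD => //; exact: ler_distD.
Qed.

Lemma fold_dist_le k (x y : diamond k) : fold_dist x y <= len k.
Proof.
elim: k x y => [|k IH] x y /=; first exact/ltW/len_gt0.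
rewrite ge_max height_le (le_trans (IH _ _)) // lenS.
by have := len_gt0 k; lra.
Qed.

Lemma fold_dist_flat k (x y : diamond k) :
  at_start x || at_stop x -> at_start y || at_stop y -> fold_dist x y = 0.
Proof.
elim: k x y => [|k IH] x y // xflat yflat.
have flat2 (z : diamond k.+1) :
    at_start z || at_stop z -> at_start z.2 || at_stop z.2.
  by case/orP => /= /andP[_ ->]; rewrite ?orbT.
by rewrite /= !height_flat // subrr normr0 IH ?flat2 // maxxx.
Qed.

Lemma base_dist_refl k (x : diamond k) : base_dist x x = 0.
Proof. by rewrite /base_dist subrr normr0 fold_dist_refl maxxx. Qed.

Lemma base_dist_sym k (x y : diamond k) : base_dist x y = base_dist y x.
Proof. by rewrite /base_dist distrC fold_dist_sym. Qed.

Lemma base_dist_triangle k (y x z : diamond k) :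
  base_dist x z <= base_dist x y + base_dist y z.
Proof. by apply: maxr_leD; [exact: ler_distD|exact: fold_dist_triangle]. Qed.

Lemma base_dist_le k (x y : diamond k) : base_dist x y <= len k.
Proof.
rewrite ge_max fold_dist_le andbT ler_norml.
have := abscissa_ge0 x; have := abscissa_ge0 y.
by have := abscissa_le x; have := abscissa_le y; lra.
Qed.

End Diamonds.

Section SeparatedDistance.
Context {R : realFieldType} {Y : eqType} {k : nat} (f : Y -> diamond k).

(* [base_dist (f y) (f z)] alone would only be a pseudometric. *)
Definition sep_dist (y z : Y) : R :=
  Num.max (y != z)%:R (base_dist (f y) (f z)).

Lemma sep_dist_ge0 y z : 0 <= sep_dist y z.
Proof. by rewrite le_max ler0n. Qed.

Lemma sep_dist_refl y : sep_dist y y = 0.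
Proof. by rewrite /sep_dist eqxx base_dist_refl maxxx. Qed.

Lemma sep_dist_sym y z : sep_dist y z = sep_dist z y.
Proof. by rewrite /sep_dist eq_sym base_dist_sym. Qed.

Lemma sep_dist_eq0 y z : sep_dist y z = 0 -> y = z.
Proof.
have [//|yz] := eqVneq y z; rewrite /sep_dist yz => dyz.
by have := le_max (1 : R) 1 (base_dist (f y) (f z)); rewrite dyz lexx ler10.
Qed.

Lemma sep_dist_triangle z y x : sep_dist y x <= sep_dist y z + sep_dist z x.
Proof.
apply: maxr_leD (base_dist_triangle _ _ _); rewrite -natrD ler_nat.
by case: (eqVneq y z) => [->|_]; case: (eqVneq z x) => //= _; case: (_ == _).
Qed.

Lemma sep_dist_le y z : sep_dist y z <= len k.
Proof.
rewrite ge_max base_dist_le andbT (le_trans (y := 1)) ?lern1 ?leq_b1 //.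
by have : 1 <= 3 ^+ k :> R; [rewrite exprn_ege1 ?ler1n|rewrite /len; lra].
Qed.

Lemma abscissa_le_sep_dist y z :
  `|abscissa (f y) - abscissa (f z)| <= sep_dist y z.
Proof. by rewrite !le_max lexx orbT. Qed.

End SeparatedDistance.

Section DiamondDistance.
Context {R : realFieldType}.

Definition diamond_dist k : diamond k -> diamond k -> R := sep_dist id.

Lemma diamond_dist_proj k (x y : diamond k.+1) : x.1.1 = y.1.1 ->
  diamond_dist x.2 y.2 <= diamond_dist x y.
Proof.
move=> xy; rewrite !ge_max !le_max (abscissaB2 xy) !lexx !orbT andbT.
by case: (eqVneq x y) => [->|_]; rewrite ?eqxx ?lern1 ?leq_b1 ?lexx.
Qed.

Lemma diamond_dist_copy k (x y : diamond k.+1) : x.1 = y.1 ->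
  diamond_dist x y <= diamond_dist x.2 y.2.
Proof.
move=> xy; have neq2 : (x != y) = (x.2 != y.2).
  by case: x y xy => [? ?] [? ?] /= ->; rewrite xpair_eqE eqxx.
rewrite !ge_max !le_max neq2 abscissaB2 ?xy // !lexx !orbT andbT /=.
by rewrite height_lip ?xy // orbT.
Qed.

Lemma diamond_dist_gap k (x y : diamond k.+1) : x.1.1 = 1 -> y.1.1 = 1 ->
  x.1.2 != y.1.2 -> 2 * len k <= diamond_dist x y.
Proof.
move=> x1 y1 xy.
have tent_mid (z : diamond k.+1) : z.1.1 = 1 -> len k <= tent z :> R.
  move=> z1; rewrite le_min lenS /= z1 mul1r.
  by have := abscissa_ge0 (R := R) z.2; have := abscissa_le (R := R) z.2; lra.
have := tent_mid x x1; have := tent_mid y y1.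
suff : `|height x - height y| <= diamond_dist x y :> R.
  have := ler_norm (height x - height y : R).
  have := ler_norm (height y - height x : R); rewrite distrC /height.
  by case: x.1.2 y.1.2 xy => [] [] // _; lra.
by rewrite !le_max lexx !orbT.
Qed.

Lemma diamond_dist_bridge k (x y : diamond k.+1) : x.1.2 = y.1.2 ->
  y.1.1 = x.1.1.+1 :> nat -> at_stop x.2 -> at_start y.2 ->
  diamond_dist x y <= clock y - clock x.
Proof.
move=> xyb xyc xs ys; have -> : clock y - clock x = 1 :> R.
  by rewrite /= (clock_stop xs) (clock_start ys) xyc -natr1; lra.
have abscissa_eq : abscissa x = abscissa y :> R.
  by rewrite /= (abscissa_stop xs) (abscissa_start ys) xyc -natr1; lra.
have fold1 : fold_dist x y <= 1 :> R.
  rewrite /= fold_dist_flat ?xs ?ys ?orbT // ge_max ler01 andbT.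
  by rewrite (le_trans (height_lip xyb)) // abscissa_eq subrr normr0.
by rewrite ge_max lern1 leq_b1 ge_max abscissa_eq subrr normr0 ler01.
Qed.

End DiamondDistance.

Section Passes.
Context {R : realType}.

(* What a pass costs to an online server: the three thirds, and the lead of the
   branch that is closed. *)
Fixpoint worth k : R :=
  if k is m.+1 then
    3 * worth m + lead (3 ^+ m.+1) (Num.truncn (worth m / 3 ^+ m.+1)) 0
  else 4.

Definition flips k := Num.truncn (worth k / 3 ^+ k.+1).

Lemma worth_ge k : 4 * 3 ^+ k <= worth k.
Proof.
elim: k => [|k IH] /=; first by rewrite mulr1.
set n := Num.truncn _; have := lead_ge0 (3 ^+ k.+1 : R) n 0.
by rewrite exprS; lra.
Qed.

Lemma flips_le k : (flips k)%:R * 3 ^+ k.+1 <= worth k.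
Proof.
rewrite -ler_pdivlMr ?exprn_gt0 // truncn_le // divr_ge0 ?exprn_ge0 //.
by apply: le_trans (worth_ge k); rewrite mulr_ge0 ?exprn_ge0.
Qed.

Local Notation dist k := (@diamond_dist R k).
Local Notation time k := (@clock R k).

Definition pass_end k : set (state R (diamond k)) :=
  [set n | flat 0 n /\ forall x, points n x -> at_stop x].

Definition pass_start k : state R (diamond k) :=
  flat_state (@at_start k) (worth k).

Lemma forces_pass0 :
  forces (dist 0) (time 0) predT 1 (@pass_end 0) (pass_start 0).
Proof.
pose spot (i : 'I_5) : state R (diamond 0) := flat_state (pred1 i) (4 - i%:R).
have spot_ok i : state_ok (dist 0) predT 1 (spot i).
  apply: flat_state_ok => // [x y|]; first exact: sep_dist_ge0.
  by exists i; rewrite /= eqxx.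
pose forced := forces (dist 0) (time 0) predT 1 (@pass_end 0).
have advance (i j : 'I_5) : j = i.+1 :> nat ->
    forced (spot j) -> forced (spot i).
  move=> ij; apply: forces_move => //; split=> /=.
  - have := @abscissa_le_sep_dist R (diamond 0) 0 id i j.
    rewrite ler_norml /= ij -natr1 => ij_dist x y /eqP -> /eqP ->.
    by rewrite /diamond_dist; lra.
  - move=> y /eqP ->; exists i; first by rewrite eqxx.
    rewrite /= ij -natr1 addrAC subrr add0r ge_max lern1 leq_b1 ge_max ler01.
    by rewrite /= ij -natr1 opprD addNKr normrN normr1 lexx.
  - by rewrite ij -natr1; lra.
have -> : pass_start 0 = spot 0 by rewrite /spot subr0.
apply: (advance 0 1) => //; apply: (advance 1 2) => //.
apply: (advance 2 3) => //; apply: (advance 3 4) => //.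
apply: forces_stop => //; split=> //.
by split=> /= [|x _]; apply/eqP; rewrite subr_eq0.
Qed.

Section PassStep.
Variable k : nat.
Local Notation step := (3 ^+ k : R).
Hypothesis pass_forces :
  forces (dist k) (time k) predT step (@pass_end k) (pass_start k).
Implicit Types (c : 'I_3) (b : bool) (T : pred ('I_3 * bool)) (a z : R).

Definition copy T a : state R (diamond k) -> state R (diamond k.+1) :=
  pull (fun y : diamond k.+1 => T y.1) snd a.

Local Notation confined T :=
  (forces (dist k.+1) (time k.+1) (fun y : diamond k.+1 => T y.1) step).
Local Notation forces_end :=
  (forces (dist k.+1) (time k.+1) predT (3 * step) (@pass_end k.+1)).

Lemma forces_copy T c a : (exists cb, T cb) -> (forall cb, T cb -> cb.1 = c) ->
  confined T (copy T a @` @pass_end k) (copy T a (pass_start k)).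
Proof.
move=> [cb Tcb] Tc; apply: forces_pull pass_forces.
- by exists (cb, origin k).
- by move=> y y' /Tc yc /Tc y'c; apply: diamond_dist_proj; rewrite yc y'c.
- by move=> x y Ty; exists (y.1, x); split=> //; exact: diamond_dist_copy.
- by move=> y /Tc yc; rewrite /= yc addrC.
Qed.

Lemma copy_bridge T c c' a n (p : state R (diamond k.+1)) :
  c' = c.+1 :> nat -> (exists x, points n x) -> pass_end n -> flat a p ->
  (forall y, points p y -> [/\ y.1.1 = c', T (c, y.1.2) & at_start y.2]) ->
  move_ok (dist k.+1) (time k.+1) (3 * step) (copy T a n) p.
Proof.
move=> cc' [x nx] [n0 n_stop] p_flat p_start; apply: flat_move p_flat _.
- by move=> y y'; exact: sep_dist_ge0.
- by rewrite mulr_ge0 ?exprn_ge0.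
- by have := flat_pull (fun y : diamond k.+1 => T y.1) snd a n0; rewrite add0r.
- move=> y /p_start[yc Ty y_start].
  exists ((c, y.1.2), x); first by rewrite /= Ty.
  by apply: diamond_dist_bridge => //=; [rewrite yc|exact: n_stop].
Qed.

Lemma forces_copy_end T a n : confined T (copy T a @` @pass_end k) n ->
  (forall m, state_ok (dist k.+1) predT (3 * step) (copy T a m) -> pass_end m ->
    (exists x, points m x) -> forces_end (copy T a m)) ->
  forces_end n.
Proof.
move=> n_forces m_forces; have step0 : 0 < step by rewrite exprn_gt0.
have n_forces' : forces (dist k.+1) (time k.+1) predT (3 * step)
    (copy T a @` @pass_end k) n.
  by apply: forces_weaken n_forces => //; lra.
apply: forces_bind n_forces' _ => p p_ok [m m_end pE]; rewrite -pE in p_ok *.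
apply: m_forces => //; have [y /= /andP[_ my]] := state_inhabited p_ok.
by exists y.2.
Qed.

Definition branch c b := [pred cb : 'I_3 * bool | cb == (c, b)].

Lemma forces_branch c b a : confined (branch c b)
  (copy (branch c b) a @` @pass_end k) (copy (branch c b) a (pass_start k)).
Proof.
apply: (@forces_copy _ c) => [|cb /eqP -> //].
by exists (c, b); rewrite /= eqxx.
Qed.

Lemma forces_last_third b n :
  confined (branch 1 b) (copy (branch 1 b) (worth k) @` @pass_end k) n ->
  forces_end n.
Proof.
move=> /forces_copy_end; apply=> m m_ok m_end mx; apply: forces_move m_ok _ _.
  apply: (@copy_bridge _ _ 2 _ _ (copy (branch 2 b) 0 (pass_start k))) => //.
    by rewrite -[X in flat X]addr0; exact: flat_pull.
  by move=> y /= /andP[/eqP -> y_start]; rewrite /= eqxx.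
apply: forces_copy_end (@forces_branch 2 b 0) _ => p p_ok [p0 p_stop] _.
apply: forces_stop => //; split.
  by rewrite -[X in flat X]addr0; exact: flat_pull.
by move=> y /= /andP[/eqP -> /p_stop ->].
Qed.

Definition race_start : state R (diamond k.+1) :=
  race (fun y : diamond k.+1 => y.1.2) step (flips k) (fun=> 2 * worth k)
    (fun b => copy (branch 1 b) (worth k) (pass_start k)).

Lemma forces_race_start : forces_end race_start.
Proof.
have step0 : 0 < step by rewrite exprn_gt0.
apply: (forces_race (dom := fun b (y : diamond k.+1) => branch 1 b y.1)
  (end_level := worth k)
  (F := fun b => copy (branch 1 b) (worth k) @` @pass_end k)).
- exact: ltW.
- by move=> x; exact: sep_dist_refl.
- by move=> b y /eqP ->.
- move=> b x y /eqP xb /eqP yb; apply: le_trans (diamond_dist_gap _ _ _).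
  + by rewrite /len; lra.
  + by rewrite xb.
  + by rewrite yb.
  + by rewrite xb yb /=; case: b {xb yb}.
- by move=> b _ [n [[n0 _] _] <-]; rewrite /= n0 add0r.
- exact: forces_last_third.
- by move=> b; exact: forces_branch.
- by move=> b; rewrite /=; lra.
- by move=> b; have := flips_le k; rewrite exprS; lra.
Qed.

Lemma forces_pass_step : forces_end (pass_start k.+1).
Proof.
pose z := 2 * worth k + lead (3 * step) (flips k) 0.
pose T := [pred cb : 'I_3 * bool | cb.1 == 0].
have worthE : worth k.+1 = worth k + z by rewrite /z -exprS /= /flips; lra.
have -> : pass_start k.+1 = copy T z (pass_start k).
  by rewrite /pass_start worthE.
apply: forces_copy_end (@forces_copy T 0 z _ _) _ =>
    [|cb /eqP //|m m_ok m_end mx].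
  by exists (0, true).
apply: forces_move forces_race_start => //; apply: (@copy_bridge _ 0 1) => //.
  by split=> [|y _] /=; rewrite subrr /z; lra.
by move=> y /= /andP[/eqP -> ->].
Qed.

End PassStep.

Lemma forces_pass k :
  forces (dist k) (time k) predT (3 ^+ k) (@pass_end k) (pass_start k).
Proof.
elim: k => [|k IH]; first exact: forces_pass0.
by rewrite exprS; exact: forces_pass_step.
Qed.

End Passes.

(** * Online and offline costs *)

Section Schedules.
Context {R : realType} {M : metricType R} {w : nat} {x0 : M}.
Implicit Types (x y : M) (s : seq M) (rho : seq (@request R M w)).
Implicit Types (A : online_algorithm x0 w).

Lemma movement_nil x : movement x [::] = 0 :> R.
Proof. by rewrite /movement big_nil. Qed.

Lemma movement_cons x y s : movement x (y :: s) = mdist x y + movement y s.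
Proof. by rewrite /movement big_cons. Qed.

Lemma movement_cat x s t :
  movement x (s ++ t) = movement x s + movement (last x s) t.
Proof. by rewrite /movement pairmap_cat big_cat. Qed.

Lemma movement_ge0 x s : 0 <= movement x s.
Proof.
elim: s x => [|y s IH] x; first by rewrite movement_nil.
by rewrite movement_cons addr_ge0 // mdist_ge0.
Qed.

Lemma serves_cat rho rho' s s' :
  serves rho s -> serves rho' s' -> serves (rho ++ rho') (s ++ s').
Proof.
elim: rho s => [|r rho IH] [|x s] //= /andP[xr rho_s] rho's'.
by rewrite /serves /= xr; exact: IH.
Qed.

Lemma opt_cost_le rho s : serves rho s -> opt_cost x0 rho <= movement x0 s.
Proof.
move=> rs; apply: ge_inf; last by exists s.
by exists 0 => _ [t _ <-]; exact: movement_ge0.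
Qed.

Lemma opt_cost_ge0 rho : 0 <= opt_cost x0 rho.
Proof.
rewrite /opt_cost; set S := [set _ | _ in _].
have [->|/set0P S0] := eqVneq S set0; first by rewrite inf0.
by apply: lb_le_inf => // _ [t _ <-]; exact: movement_ge0.
Qed.

Lemma trajectory_rcons A rho r :
  trajectory A (rcons rho r) = rcons (trajectory A rho) (A (rcons rho r)).
Proof.
rewrite /trajectory size_rcons -addn1 iotaD map_cat /= add0n cats1.
rewrite take_oversize ?size_rcons //; congr rcons; apply/eq_in_map => i.
by rewrite mem_iota -cats1 => /andP[_ ir]; rewrite takel_cat.
Qed.

Lemma last_trajectory A rho : last x0 (trajectory A rho) = A rho.
Proof.
case/lastP: rho => [|rho r]; first by rewrite position_nil.
by rewrite trajectory_rcons last_rcons.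
Qed.

Lemma serves_trajectory A rho : serves rho (trajectory A rho).
Proof.
elim/last_ind: rho => // rho r IH; rewrite trajectory_rcons -!cats1.
by rewrite serves_cat // /serves /= cats1 position_rcons.
Qed.

Lemma alg_cost_nil A : alg_cost [::] A = 0.
Proof. exact: movement_nil. Qed.

Lemma alg_cost_rcons A rho r :
  alg_cost (rcons rho r) A = alg_cost rho A + mdist (A rho) (A (rcons rho r)).
Proof.
rewrite /alg_cost trajectory_rcons -cats1 movement_cat movement_cons.
by rewrite last_trajectory movement_nil addr0.
Qed.

Lemma opt_cost_le_alg_cost A rho : opt_cost x0 rho <= alg_cost rho A.
Proof. exact/opt_cost_le/serves_trajectory. Qed.

End Schedules.

Section Expectation.
Context {R : realType} {M : metricType R} {w : nat} {x0 : M}.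
Variable P : @randomized_algorithm R M x0 w.
Local Notation space := (@algorithm_space R M x0 w).
Implicit Types (rho : seq (@request R M w)).

Definition last_request rho : {fset M} :=
  if rho is r :: rho' then val (last r rho') else [fset x0]%fset.

Lemma position_last_request (A : space) rho :
  position A rho \in last_request rho.
Proof.
case/lastP: rho => [|rho r]; first by rewrite position_nil inE.
suff -> : last_request (rcons rho r) = val r by exact: position_rcons.
by case: rho => //= r' rho; rewrite last_rcons.
Qed.

Lemma measurable_decision rho (x : M) :
  measurable ([set A | position A rho = x] : set space).
Proof. by apply: sub_gen_smallest; exists rho, x. Qed.

(* A decision takes finitely many values, so that a function of two decisions is
   a combination of indicators. *)
Lemma integrable_decisions (f : M -> M -> R) rho rho' :
  P.-integrable [set: space]
    (EFin \o fun A => f (position A rho) (position A rho')).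
Proof.
pose decides rho x := [set A | position A rho = x] : set space.
have -> : EFin \o (fun A => f (position A rho) (position A rho')) =
    (fun A => \sum_(x <- last_request rho) \sum_(y <- last_request rho')
       (f x y)%:E * (\1_(decides rho x `&` decides rho' y) A)%:E)%E.
  apply/funext => A.
  rewrite (bigD1_seq (position A rho)) ?position_last_request ?fset_uniq //=.
  rewrite (bigD1_seq (position A rho')) ?position_last_request ?fset_uniq //=.
  rewrite indicE mem_set //= mule1 !big1 ?adde0 // => x /eqP nx.
    by rewrite big1 // => y _; rewrite indicE memNset ?mule0 // => -[/esym].
  by rewrite indicE memNset ?mule0 // => -[_ /esym].
apply: integrable_sum => // x _; apply: integrable_sum => // y _.
apply: integrableZl => //; apply: integrable_indic.
by apply: measurableI; exact: measurable_decision.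
Qed.

Lemma integrable_alg_cost rho :
  P.-integrable [set: space] (EFin \o alg_cost rho).
Proof.
elim/last_ind: rho => [|rho r IH].
  have -> : @alg_cost R M x0 w [::] = cst 0.
    by apply/funext => A; exact: alg_cost_nil.
  exact: finite_measure_integrable_cst.
rewrite (_ : EFin \o _ = EFin \o alg_cost rho \+ (EFin \o fun A : space =>
    mdist (position A rho) (position A (rcons rho r))))%E.
  by apply: integrableD => //; exact: integrable_decisions.
by apply/funext => A; rewrite /= alg_cost_rcons.
Qed.

Definition expected_cost rho : R := \int[P]_A alg_cost rho A.

Lemma expectation_alg_cost rho :
  ('E_P[@alg_cost R M x0 w rho] = (expected_cost rho)%:E)%E.
Proof.
rewrite unlock /expected_cost /Rintegral fineK //.
exact: integrable_fin_num (integrable_alg_cost rho).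
Qed.

Lemma expected_cost_ge0 rho : 0 <= expected_cost rho.
Proof.
rewrite -lee_fin -expectation_alg_cost; apply: expectation_ge0 => A.
exact: movement_ge0.
Qed.

End Expectation.

Section LowerBounds.
Context {R : realType} {M : metricType R} {w : nat} (x0 : M).

Lemma C_rand_MSS_ge (cost period start : R) : 0 < cost -> 0 < period ->
  (forall (P : @randomized_algorithm R M x0 w) (n : nat), exists rho,
     opt_cost x0 rho <= start + n%:R * period /\
     n%:R * cost <= expected_cost P rho) ->
  ((cost / period)%:E <= C_rand_MSS x0 w)%E.
Proof.
move=> cost0 period0 family.
apply: le_ereal_inf_tmp => _ [C [P [kappa comp]] <-].
rewrite lee_fin leNgt; apply/negP => C_lt; pose C' := Num.max C 0.
have C'0 : 0 <= C' by rewrite le_max lexx orbT.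
have gain0 : 0 < cost - C' * period.
  by rewrite subr_gt0 -ltr_pdivlMr // gt_max C_lt divr_gt0.
pose n := (Num.truncn ((C' * start + kappa) / (cost - C' * period))).+1.
have : C' * start + kappa < n%:R * (cost - C' * period).
  by rewrite -ltr_pdivrMr // truncnS_gt.
have [rho [opt_rho cost_rho]] := family P n.
have := comp rho; rewrite expectation_alg_cost lee_fin.
have : C * opt_cost x0 rho <= C' * opt_cost x0 rho.
  by rewrite ler_wpM2r ?opt_cost_ge0 // le_max lexx.
have : C' * opt_cost x0 rho <= C' * (start + n%:R * period).
  by rewrite ler_wpM2l.
by lra.
Qed.

Section Alternation.
Hypothesis w_gt0 : (0 < w)%N.

Lemma singleton_requestP (x : M) :
  ([fset x] != fset0)%fset && (#|` [fset x]%fset| <= w)%N.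
Proof.
by rewrite cardfs1 w_gt0 andbT; apply/fset0Pn; exists x; rewrite inE.
Qed.

Definition singleton_request x : @request R M w :=
  exist _ [fset x]%fset (singleton_requestP x).

Variables p q : M.

Definition alternation n : seq (@request R M w) :=
  mkseq (fun i => singleton_request (if odd i then q else p)) n.+1.

Lemma position_alternation (A : online_algorithm x0 w) n :
  A (alternation n) = if odd n then q else p.
Proof.
rewrite /alternation mkseqS; set rho := mkseq _ n.
by have := position_rcons A rho (singleton_request (if odd n then q else p));
  rewrite inE => /eqP.
Qed.

Lemma alg_cost_alternation (A : online_algorithm x0 w) n :
  alg_cost (alternation n) A = mdist x0 p + n%:R * mdist p q.
Proof.
elim: n => [|n IH].
  rewrite -[alternation 0]/(rcons [::] _) alg_cost_rcons alg_cost_nil.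
  by rewrite position_nil (position_alternation A 0) mul0r addr0 add0r.
have altS : alternation n.+1 = rcons (alternation n) _ := mkseqS _ _.
rewrite altS alg_cost_rcons -altS IH !position_alternation.
rewrite -natr1 mulrDl mul1r addrA; congr (_ + _).
by rewrite /=; case: (odd n); rewrite // metric_sym.
Qed.

(* The requests leave no choice to the server. *)
Lemma C_rand_MSS_ge1 : p != q -> (1 <= C_rand_MSS x0 w)%E.
Proof.
move=> pq; have d0 : 0 < mdist p q by rewrite mdist_gt0.
rewrite -(divff (lt0r_neq0 d0)).
apply: (C_rand_MSS_ge (start := mdist x0 p)) => // P n.
exists (alternation n); split.
  rewrite -(alg_cost_alternation (default_algorithm x0 w)).
  exact: opt_cost_le_alg_cost.
suff -> : expected_cost P (alternation n) = mdist x0 p + n%:R * mdist p q.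
  by rewrite lerDr mdist_ge0.
apply: EFin_inj; rewrite -expectation_alg_cost -(expectation_cst P).
by congr ('E_P[_])%E; apply/funext => A; exact: alg_cost_alternation.
Qed.

End Alternation.

Section ForcedPlay.
Variables (P : @randomized_algorithm R M x0 w) (zone : @request R M w).
Variables (clock : M -> R) (step top : R) (F : set (state R M)).
Hypothesis F_end : forall n x, F n -> points n x ->
  potential n x <= 0 /\ clock x <= top.
Implicit Types (n m : state R M) (rho : seq (@request R M w)) (s : seq M).

Local Notation in_zone := (fun x => x \in val zone).
Local Notation ok := (state_ok (@mdist R M) in_zone step).

Definition request_of (S : M -> bool) : @request R M w :=
  insubd zone [fset x in val zone | S x]%fset.

Lemma in_request_of n x :
  ok n -> (x \in val (request_of (points n))) = points n x.
Proof.
move=> nok.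
have memE y : (y \in [fset y in val zone | points n y]%fset) = points n y.
  by rewrite !inE; apply: andb_idl; exact: state_dom nok y.
rewrite insubdK ?memE //; apply/andP; split.
  by have [y ny] := state_inhabited nok; apply/fset0Pn; exists y; rewrite memE.
have /andP[_] := valP zone; apply: leq_trans.
by apply: fsubset_leq_card; apply/fsubsetP => y; rewrite !inE => /andP[].
Qed.

Definition value n rho : R :=
  \int[P]_A (alg_cost rho A + potential n (position A rho)).

Lemma integrable_value n rho : P.-integrable setT
  (EFin \o fun A => alg_cost rho A + potential n (position A rho)).
Proof.
have pot := @integrable_decisions R M w x0 P (fun x _ => potential n x) rho rho.
exact: integrableD (integrable_alg_cost P rho) pot.
Qed.

Lemma value_le n m rho rho' :
  (forall A : online_algorithm x0 w, alg_cost rho A + potential n (A rho) <=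
     alg_cost rho' A + potential m (A rho')) ->
  value n rho <= value m rho'.
Proof. by move=> nm; apply: le_Rintegral => //; exact: integrable_value. Qed.

Lemma value_move n m rho : move_ok (@mdist R M) clock step n m -> ok m ->
  (forall A : online_algorithm x0 w, points n (A rho)) ->
  value n rho <= value m (rcons rho (request_of (points m))).
Proof.
move=> nm mok nA; apply: value_le => A; rewrite alg_cost_rcons.
set r := request_of _; have mA : points m (A (rcons rho r)).
  by rewrite -in_request_of //; exact: position_rcons.
by have := move_potential nm (nA A) mA; lra.
Qed.

Lemma value_flip n (f : bool -> state R M) rho : flip_ok step n f ->
  (forall A : online_algorithm x0 w, points n (A rho)) ->
  exists b, value n rho <= value (f b) rho.
Proof.
move=> [_ np _] nA.
have mean : value n rho + value n rho <=
    value (f true) rho + value (f false) rho.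
  rewrite -!RintegralD //; try exact: integrable_value.
  apply: le_Rintegral => //.
  - exact: integrableD (integrable_value n rho) (integrable_value n rho).
  - exact: integrableD (integrable_value (f true) rho) (integrable_value _ rho).
  - by move=> A _; have := np _ (nA A); lra.
have [ft|tf] := leP (value (f false) rho) (value (f true) rho).
  by exists true; lra.
by exists false; lra.
Qed.

(* At each flip, the adversary may as well choose the better outcome for itself,
   as the offline server is not affected. *)
Lemma forced_play n rho : forces (@mdist R M) clock in_zone step F n ->
  (forall A : online_algorithm x0 w, points n (A rho)) ->
  exists sigma x s, [/\ points n x, serves sigma s,
    movement x s <= top - clock x &
    value n rho <= expected_cost P (rho ++ sigma)].
Proof.
move=> n_forces; elim: n_forces rho =>
  {n} [n nok nF|n m nok nm m_forces IH|n f nok nf _ IH] rho nA.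
- have [x nx] := state_inhabited nok; exists [::], x, [::]; split=> //.
    by rewrite movement_nil subr_ge0; have [] := F_end nF nx.
  rewrite cats0; apply: le_Rintegral => //; first exact: integrable_value.
    exact: integrable_alg_cost.
  by move=> A _; rewrite gerDl; have [] := F_end nF (nA A).
- have mok := forces_ok m_forces; pose r := request_of (points m).
  have [A|sigma [y [s [my sigma_s ys cost]]]] := IH (rcons rho r).
    by rewrite -in_request_of //; exact: position_rcons.
  have [x nx xy] := move_reach nm my.
  exists (r :: sigma), x, (y :: s); split=> //.
  + by rewrite /serves /= in_request_of // my.
  + by rewrite movement_cons; lra.
  + by rewrite -cat_rcons; exact: le_trans (value_move nm mok nA) cost.
- have [b nb] := value_flip nf nA.
  have [A|sigma [x [s [fx sigma_s xs cost]]]] := IH b rho.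
    by rewrite (flip_points nf).
  exists sigma, x, s; split=> //; first by rewrite -(flip_points nf b).
  exact: le_trans nb cost.
Qed.

Variables (worth diam : R) (n : state R M).
Hypothesis n_forces : forces (@mdist R M) clock in_zone step F n.
Hypothesis n_start : forall x, points n x ->
  worth <= potential n x /\ 0 <= clock x.
Hypothesis le_diam : forall x y : M, mdist x y <= diam.

Lemma expected_cost_le_value rho : expected_cost P rho + worth <=
  value n (rcons rho (request_of (points n))).
Proof.
have worthE : \int[P]_(A in [set: @algorithm_space R M x0 w]) worth = worth.
  by have := expectation_cst P worth; rewrite unlock /Rintegral => ->.
have cst_int := finite_measure_integrable_cst P worth measurableT.
have cost_int := integrable_alg_cost P rho.
rewrite -[X in _ + X]worthE -RintegralD //.
apply: le_Rintegral (integrableD _ cost_int cst_int) _ _ => //.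
  exact: integrable_value.
move=> A _ /=; rewrite alg_cost_rcons; set r := request_of _.
have /n_start[] : points n (A (rcons rho r)).
  by rewrite -(in_request_of _ (forces_ok n_forces)) position_rcons.
by have := mdist_ge0 (A rho) (A (rcons rho r)); lra.
Qed.

Lemma forced_plays k : exists rho s, [/\ serves rho s,
  movement x0 s <= k%:R * (top + diam) & k%:R * worth <= expected_cost P rho].
Proof.
elim: k => [|k [rho [s [rho_s s_le rho_ge]]]].
  exists [::], [::]; rewrite movement_nil !mul0r; split=> //.
  exact: expected_cost_ge0.
have nok := forces_ok n_forces; pose r := request_of (points n).
have [A|sigma [x [t [nx sigma_t t_le sigma_ge]]]] :=
    forced_play (rho := rcons rho r) n_forces.
  by rewrite -in_request_of // position_rcons.
exists (rcons rho r ++ sigma), (s ++ x :: t); split.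
- by rewrite cat_rcons serves_cat // /serves /= in_request_of // nx.
- rewrite movement_cat movement_cons -natr1.
  by have := le_diam (last x0 s) x; have [_] := n_start nx; lra.
- rewrite -natr1; apply: le_trans sigma_ge.
  by have := expected_cost_le_value rho; rewrite -/r; lra.
Qed.

End ForcedPlay.

Lemma C_rand_MSS_forces (zone : @request R M w) clock
    (step top worth diam : R) F n :
  (forall n x, F n -> points n x -> potential n x <= 0 /\ clock x <= top) ->
  forces (@mdist R M) clock (fun x => x \in val zone) step F n ->
  (forall x, points n x -> worth <= potential n x /\ 0 <= clock x) ->
  (forall x y : M, mdist x y <= diam) -> 0 < worth -> 0 < top + diam ->
  ((worth / (top + diam))%:E <= C_rand_MSS x0 w)%E.
Proof.
move=> F_end n_forces n_start le_diam worth0 period0.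
apply: (C_rand_MSS_ge (start := 0)) => // P k; rewrite add0r.
have [rho [s [rho_s s_le rho_ge]]] :=
  forced_plays P F_end n_forces n_start le_diam k.
by exists rho; split=> //; exact: le_trans (opt_cost_le rho_s) s_le.
Qed.

End LowerBounds.

(** * Lower bounds *)

Section Growth.
Context {R : realType}.

Lemma lead_truncn (D r : R) : 0 <= D -> 4 <= r ->
  D * Num.sqrt r / 12 <= lead D (Num.truncn (r / 3)) 0.
Proof.
move=> D0 r4; set n := Num.truncn _; apply: le_trans (lead_sqrt D n).
have : r / 3 < n.+1%:R by rewrite truncnS_gt.
rewrite -(natr1 n) => rn; have sqrt_le : Num.sqrt r / 2 <= Num.sqrt (3 * n%:R).
  rewrite -(ler_pXn2r (n := 2)) ?nnegrE ?divr_ge0 ?sqrtr_ge0 // expr_div_n.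
  by rewrite !sqr_sqrtr ?mulr_ge0 //; lra.
by have := ler_wpM2l D0 sqrt_le; lra.
Qed.

Lemma worth_quadratic k : (k.+2%:R / 25) ^+ 2 * 3 ^+ k <= worth k :> R.
Proof.
elim: k => [|k IH] /=; first by rewrite expr0; lra.
have pow_gt0 : 0 < 3 ^+ k :> R by rewrite exprn_gt0.
pose r : R := worth k / 3 ^+ k; have worthE : worth k = r * 3 ^+ k.
  by rewrite divfK ?gt_eqF.
have r_ge4 : 4 <= r by rewrite ler_pdivlMr // worth_ge.
have -> : worth k / 3 ^+ k.+1 = r / 3 by rewrite exprS invfM mulrCA mulrC.
have := lead_truncn (exprn_ge0 k.+1 (ler0n _ 3)) r_ge4.
rewrite worthE in IH *; rewrite exprS; rewrite ler_pM2r // in IH.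
set q := Num.sqrt r; have q_sq : q ^+ 2 = r by rewrite sqr_sqrtr //; lra.
have q0 : 0 <= q by exact: sqrtr_ge0.
have q_ge2 : 2 <= q by rewrite -(ler_pXn2r (n := 2)) ?nnegrE // q_sq; lra.
have k2_le : k.+2%:R / 25 <= q.
  by rewrite -(ler_pXn2r (n := 2)) ?nnegrE ?divr_ge0 // q_sq.
have k3_le : (k.+3%:R / 25) ^+ 2 <= (q + 1 / 25) ^+ 2.
  by rewrite ler_pXn2r ?nnegrE ?divr_ge0 -?(natr1 k.+2) //; lra.
have : (k.+3%:R / 25) ^+ 2 * 3 ^+ k <= (r + q / 12) * 3 ^+ k.
  by rewrite ler_pM2r // (le_trans k3_le) // -q_sq; lra.
by lra.
Qed.

End Growth.

Definition folded (Y : choiceType) k (f : Y -> diamond k) : Type := Y.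

Section FoldedSpace.
Context {R : realType} {Y : choiceType} {k : nat} (f : Y -> diamond k).

HB.instance Definition _ := Choice.copy (folded f) Y.
HB.instance Definition _ := @isMetric.Build R (folded f) (sep_dist f)
  (sep_dist_refl f) (@sep_dist_eq0 R _ _ f) (sep_dist_sym f)
  (sep_dist_triangle f).

Local Notation M := (folded f : metricType R).
Variables (s : diamond k -> M) (w : nat).
Hypothesis sK : cancel s f.
Hypothesis le_w : (5 * 6 ^ k <= w)%N.

Lemma section_request :
  exists zone : @request R M w, forall y, (y \in val zone) = (s (f y) == y).
Proof.
pose Z : {fset M} := [fset y in [seq s x | x <- enum (diamond k)]]%fset.
have ZE y : (y \in Z) = (s (f y) == y).
  rewrite inE /=; apply/mapP/eqP => [[x _ ->]|<-]; first by rewrite sK.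
  by exists (f y); rewrite ?mem_enum.
suff ZP : (Z != fset0)%fset && (#|` Z|%fset <= w)%N by exists (exist _ Z ZP).
apply/andP; split; first by apply/fset0Pn; exists (s (origin k)); rewrite ZE sK.
rewrite card_fseq (leq_trans (size_undup _)) // size_map -cardE card_diamond.
exact: le_w.
Qed.

Lemma C_rand_MSS_folded (x0 : M) :
  ((worth k / (9 * 3 ^+ k))%:E <= C_rand_MSS x0 w)%E.
Proof.
have [zone zoneE] := section_request; pose in_zone (y : M) := y \in val zone.
have pow_gt0 : 0 < 3 ^+ k :> R by rewrite exprn_gt0.
have : forces (@mdist R M) (fun y => clock (f y)) in_zone (3 ^+ k)
    (pull in_zone f 0 @` @pass_end R k) (pull in_zone f 0 (pass_start k)).
  apply: (forces_pull (delay := 0) _ _ _ _ _ (forces_pass k)).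
  - by exists (s (origin k)); rewrite /in_zone zoneE sK.
  - move=> y y' _ _; rewrite ge_max [X in _ && X]le_max lexx orbT andbT le_max.
    by rewrite ler_nat; case: (eqVneq y y') => [->|_]; rewrite ?eqxx ?leq_b1.
  - move=> x y; rewrite {1}/in_zone zoneE => /eqP sfy.
    exists (s x); rewrite /in_zone zoneE sK; split=> //.
    rewrite -{1}sfy ge_max; apply/andP; split; rewrite le_max; apply/orP.
      by left; rewrite (can_eq sK).
    by right; rewrite !sK.
  - by move=> y _; rewrite addr0.
have -> : 9 * 3 ^+ k = 5 * 3 ^+ k + len k :> R by rewrite /len; lra.
move=> /C_rand_MSS_forces; apply.
- move=> _ y [n [[_ n0] n_stop] <-] /= /andP[_ ny].
  rewrite n0 // addr0; split=> //.
  by rewrite (clock_stop (n_stop _ ny)); lra.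
- by move=> y /= /andP[_ /clock_start ->]; rewrite addr0.
- exact: sep_dist_le.
- by apply: lt_le_trans (worth_ge k); rewrite mulr_gt0.
- by rewrite /len; lra.
Qed.

End FoldedSpace.

(* The indices in excess are sent to the origin. *)
Definition diamond_cover k n (i : 'I_n) : diamond k :=
  nth (origin k) (enum (diamond k)) i.

Lemma diamond_coverK k n : (5 * 6 ^ k <= n.+1)%N ->
  cancel (fun x => inord (enum_rank x)) (@diamond_cover k n.+1).
Proof.
move=> le_n x; rewrite /diamond_cover inordK ?nth_enum_rank //.
by rewrite (leq_trans (ltn_ord _)) // card_diamond.
Qed.

(* The diamond of level 0 does not fit in the smallest spaces, where the trivial
   bound is enough. *)
Lemma C_rand_MSS_diamond_cover (R : realType) k n
    (x0 : folded (@diamond_cover k n.+2) : metricType R) :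
  k = 0%N \/ (5 * 6 ^ k <= n.+1)%N ->
  (((k.+2%:R / 75) ^+ 2)%:E <= C_rand_MSS x0 n.+1)%E.
Proof.
case=> [k0|le_n].
  apply: le_trans (C_rand_MSS_ge1 x0 _ (p := ord0) (q := ord_max) _) => //.
  by rewrite k0 lee_fin; lra.
have pow_gt0 : 0 < 3 ^+ k :> R by rewrite exprn_gt0.
apply: le_trans (C_rand_MSS_folded (diamond_coverK (leqW le_n)) le_n x0).
rewrite lee_fin ler_pdivlMr ?mulr_gt0 //.
by have := @worth_quadratic R k; lra.
Qed.

Lemma ln_le_trunc_log (R : realType) n :
  ln n.+2%:R <= 6 * (trunc_log 6 (n.+1 %/ 5)).+2%:R :> R.
Proof.
set k := trunc_log _ _; have le_pow : (n.+2 <= 6 ^ k.+2)%N.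
  have := trunc_log_ltn (n.+1 %/ 5) (isT : 1 < 6)%N.
  rewrite -/k ltn_divLR // => le_n.
  by rewrite (leq_trans le_n) // [leqRHS]expnS mulnC leq_mul.
apply: le_trans (_ : ln (6 ^ k.+2)%:R <= _).
  by rewrite ler_ln ?posrE ?ltr0n ?expn_gt0 // ler_nat.
have ln6 : ln 6 <= 6 :> R by rewrite ltW // ln_sublinear.
by rewrite natrX lnXn // -[ln _ *+ _]mulr_natr ler_wpM2r.
Qed.

Theorem theorem2 (R : realType) :
  exists c : R, 0 < c /\
    forall n : nat, (2 <= n)%N ->
      exists M : metricType R, ([set: M] #= `I_n)%card /\
        forall x0 : M, ((c * ln n%:R ^+ 2)%:E <= C_rand_MSS x0 n.-1)%E.
Proof.
exists (450^-1 ^+ 2); split; first by rewrite exprn_gt0 ?invr_gt0.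
case=> [|[|n]] // _; set k := trunc_log 6 (n.+1 %/ 5).
exists (folded (@diamond_cover k n.+2)); split.
  by rewrite card_eq_sym; exact: card_II.
move=> x0; apply: le_trans (C_rand_MSS_diamond_cover x0 _).
  rewrite lee_fin -exprMn ler_pXn2r ?nnegrE ?mulr_ge0 ?ln_ge0 ?ler1n //.
  by have := ln_le_trunc_log R n; rewrite -/k; lra.
have [n5|n5] := posnP (n.+1 %/ 5); first by left; rewrite /k n5.
right; have := trunc_logP (isT : 1 < 6)%N n5; rewrite -/k.
by rewrite mulnC -leq_divRL.
Qed.
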